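(* Let $S$ be a Noetherian semidomain. Then $S$ is a multiplication semiring if and only if $S$ is a Dedekind semidomain.
   Context: A semiring is $(S,+,\cdot,0,1)$ where $(S,+,0)$ and $(S,\cdot,1)$ are commutative monoids, $1\neq 0$, multiplication distributes over addition, and $a\cdot 0=0$ for all $a$. A semidomain is a semiring $S$ in which $ab=ac$ with $a\neq 0$ implies $b=c$. Its semifield of fractions $K=F(S)$ is the localization of $S$ at $S-\{0\}$. An ideal of $S$ is a nonempty subset closed under addition and under multiplication by elements of $S$. $S$ is Noetherian if each ideal of $S$ is finitely generated. The product $\mathfrak{b}\mathfrak{c}$ of ideals is the set of finite sums $\sum b_ic_i$ with $b_i\in\mathfrak{b}$, $c_i\in\mathfrak{c}$. A semiring $S$ is multiplication if, whenever $\mathfrak{a}\subseteq\mathfrak{b}$ are ideals of $S$, there is an ideal $\mathfrak{c}$ of $S$ with $\mathfrak{a}=\mathfrak{b}\mathfrak{c}$. A fractional ideal of $S$ is a nonempty subset $A\subseteq K$ closed under addition and under multiplication by elements of $S$ such that $dA\subseteq S$ for some nonzero $d\in S$. The product $AB$ of fractional ideals $A$ and $B$ is the set of finite sums $\sum a_ib_i$ with $a_i\in A$, $b_i\in B$, and $A$ is invertible if $AB=S$ for some fractional ideal $B$. A Dedekind semidomain is a semidomain in which each nonzero fractional ideal is invertible. *)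

(* Defs.v *)
From HB Require Import structures.
From mathcomp Require Import all_boot all_order all_algebra.
From mathcomp Require Import generic_quotient ssrAC.
From mathcomp Require Import boolp classical_sets.

Set Implicit Arguments.
Unset Strict Implicit.
Unset Printing Implicit Defensive.

Import GRing.Theory.

Local Open Scope classical_set_scope.
Local Open Scope ring_scope.

(* All semirings are commutative with 1 != 0, i.e. comNzSemiRingType. *)
HB.mixin Record ComNzSemiRing_isSemidomain S of GRing.ComNzSemiRing S := {
  sdom_mulfI : forall a b c : S, a != 0 -> a * b = a * c -> b = c
}.

#[short(type="semidomainType")]
HB.structure Definition Semidomain :=
  { S of GRing.ComNzSemiRing S & ComNzSemiRing_isSemidomain S }.

Arguments sdom_mulfI {s} [a b c] _ _.

Lemma sdom_mulf_neq0 (S : semidomainType) (a b : S) :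
  a != 0 -> b != 0 -> a * b != 0.
Proof.
move=> a0; apply: contra_neq => ab0.
by apply: (sdom_mulfI a0); rewrite ab0 mulr0.
Qed.

(* mathcomp's {fraction R} requires an idomainType, hence subtraction; the
   construction is repeated here for semidomains. *)
Module SemiFrac.
Section SemiFrac.
Local Open Scope quotient_scope.
Context (S : semidomainType).

Record ratio := Ratio { frac :> S * S; denom_neq0 : frac.2 != 0 }.

HB.instance Definition _ := [isSub for frac].
HB.instance Definition _ := [Choice of ratio by <:].

Implicit Types (x y z : ratio) (s : S).

(* In a semidomain, a/b ~ c/d iff uad = ubc for some u != 0 amounts to
   ad = bc. *)
Definition equivf x y := x.1 * y.2 == x.2 * y.1.

Lemma equivf_refl : reflexive equivf.
Proof. by move=> x; rewrite /equivf mulrC. Qed.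

Lemma equivf_sym : symmetric equivf.
Proof.
by move=> x y; rewrite /equivf eq_sym; congr (_ == _); rewrite mulrC.
Qed.

Lemma equivf_trans : transitive equivf.
Proof.
move=> [y Py] [x Px] [z Pz]; rewrite /equivf /= => /eqP xy /eqP yz.
apply/eqP/(sdom_mulfI Py).
by rewrite mulrCA mulrA [_ * y.2]mulrC [y.2 * _]mulrC xy -mulrA yz mulrCA.
Qed.

Canonical equivf_equiv := EquivRel equivf equivf_refl equivf_sym equivf_trans.

Definition type := {eq_quot equivf}.

HB.instance Definition _ : EqQuotient _ equivf type := EqQuotient.on type.
HB.instance Definition _ := Choice.on type.

Lemma piP x y : reflect (x.1 * y.2 = x.2 * y.1) (\pi_type x == \pi_type y).
Proof. by rewrite eqmodE; exact: eqP. Qed.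

Lemma repr_pi x :
  (repr (\pi_type x)).1 * x.2 = (repr (\pi_type x)).2 * x.1.
Proof. by apply/piP; rewrite reprK. Qed.

Definition ofS s : ratio := @Ratio (s, 1) (oner_neq0 S).

Definition addf x y : ratio :=
  @Ratio (x.1 * y.2 + y.1 * x.2, x.2 * y.2)
    (sdom_mulf_neq0 (denom_neq0 x) (denom_neq0 y)).

Definition mulf x y : ratio :=
  @Ratio (x.1 * y.1, x.2 * y.2)
    (sdom_mulf_neq0 (denom_neq0 x) (denom_neq0 y)).

Definition tofrac s : type := \pi_type (ofS s).
Definition add (a b : type) : type := \pi_type (addf (repr a) (repr b)).
Definition mul (a b : type) : type := \pi_type (mulf (repr a) (repr b)).

Lemma pi_add x y : add (\pi_type x) (\pi_type y) = \pi_type (addf x y).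
Proof.
apply/eqP/piP => /=; have := repr_pi x; have := repr_pi y.
move: (repr _) => y'; move: (repr _) => x' ey ex.
rewrite mulrDl mulrDr; congr (_ + _).
  by rewrite (AC (2*2) ((1*3)*(2*4))) /= ex (AC (2*2) ((1*3)*(2*4))).
by rewrite (AC (2*2) ((1*4)*(2*3))) /= ey (AC (2*2) ((3*1)*(2*4))).
Qed.

Lemma pi_mul x y : mul (\pi_type x) (\pi_type y) = \pi_type (mulf x y).
Proof.
by apply/eqP/piP => /=; rewrite mulrACA !repr_pi mulrACA.
Qed.

Lemma addA : associative add.
Proof.
elim/quotW=> x; elim/quotW=> y; elim/quotW=> z.
rewrite (pi_add y z) (pi_add x y) (pi_add x (addf y z)) (pi_add (addf x y) z).
congr \pi_type; apply: val_inj; congr (_, _) => /=; last by rewrite mulrA.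
by rewrite !mulrDl !mulrA addrA (mulrAC y.1) (mulrAC z.1).
Qed.

Lemma addC : commutative add.
Proof.
elim/quotW=> x; elim/quotW=> y; rewrite !pi_add.
by congr \pi_type; apply: val_inj; rewrite /= addrC [x.2 * _]mulrC.
Qed.

Lemma add0 : left_id (tofrac 0) add.
Proof.
elim/quotW=> x; rewrite pi_add; congr \pi_type; apply: val_inj => /=.
by rewrite mul0r add0r mulr1 mul1r -surjective_pairing.
Qed.

HB.instance Definition _ := GRing.isNmodule.Build type addA addC add0.

Lemma mulA : associative mul.
Proof.
elim/quotW=> x; elim/quotW=> y; elim/quotW=> z.
rewrite (pi_mul y z) (pi_mul x y) (pi_mul x (mulf y z)) (pi_mul (mulf x y) z).
by congr \pi_type; apply: val_inj; rewrite /= !mulrA.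
Qed.

Lemma mulC : commutative mul.
Proof.
elim/quotW=> x; elim/quotW=> y; rewrite !pi_mul.
by congr \pi_type; apply: val_inj; rewrite /= mulrC [x.2 * _]mulrC.
Qed.

Lemma mul1 : left_id (tofrac 1) mul.
Proof.
elim/quotW=> x; rewrite pi_mul; congr \pi_type; apply: val_inj => /=.
by rewrite !mul1r -surjective_pairing.
Qed.

Lemma mulDl : left_distributive mul add.
Proof.
elim/quotW=> x; elim/quotW=> y; elim/quotW=> z.
rewrite (pi_add x y) (pi_mul x z) (pi_mul y z) (pi_mul (addf x y) z).
rewrite (pi_add (mulf x z) (mulf y z)); apply/eqP/piP => /=.
rewrite !mulrDl !mulrDr; congr (_ + _).
  by rewrite (AC (3*(2*2)) (4*2*5*((1*3)*(6*7)))).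
by rewrite (AC (3*(2*2)) (4*6*5*((1*3)*(2*7)))).
Qed.

Lemma mul0 : left_zero (tofrac 0) mul.
Proof.
elim/quotW=> x; rewrite pi_mul; apply/eqP/piP => /=.
by rewrite !mul0r mulr0.
Qed.

Lemma one_neq0 : tofrac 1 != tofrac 0.
Proof. by apply/piP => /=; rewrite !mulr1 mulr0; apply/eqP/oner_neq0. Qed.

HB.instance Definition _ := GRing.Nmodule_isComNzSemiRing.Build type
  mulA mulC mul1 mulDl mul0 one_neq0.

Lemma tofrac_is_nmod_morphism : nmod_morphism tofrac.
Proof.
split=> // s t; rewrite [RHS]pi_add; congr \pi_type; apply: val_inj => /=.
by rewrite !mulr1.
Qed.

HB.instance Definition _ :=
  GRing.isNmodMorphism.Build S type tofrac tofrac_is_nmod_morphism.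

Lemma tofrac_is_monoid_morphism : monoid_morphism tofrac.
Proof.
split=> // s t; rewrite [RHS]pi_mul; congr \pi_type; apply: val_inj => /=.
by rewrite !mulr1.
Qed.

HB.instance Definition _ :=
  GRing.isMonoidMorphism.Build S type tofrac tofrac_is_monoid_morphism.

End SemiFrac.
End SemiFrac.
HB.export SemiFrac.

Notation "{ 'semifrac' S }" := (SemiFrac.type S)
  (at level 0, format "{ 'semifrac'  S }") : type_scope.
Notation tosemifrac := (@SemiFrac.tofrac _).

Section SemiFracTheory.
Context (S : semidomainType).

Lemma tosemifrac_inj : injective (tosemifrac : S -> {semifrac S}).
Proof. by move=> s t /eqP/SemiFrac.piP /=; rewrite mulr1 mul1r. Qed.

Lemma tosemifrac_inv (s : S) :
  s != 0 -> exists k : {semifrac S}, tosemifrac s * k = 1.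
Proof.
move=> s0; exists (\pi_({semifrac S})%qT (@SemiFrac.Ratio S (1, s) s0)).
rewrite [LHS]SemiFrac.pi_mul; apply/eqP/SemiFrac.piP => /=.
by rewrite !mulr1 mul1r.
Qed.

Lemma semifracP (k : {semifrac S}) :
  exists a b : S, b != 0 /\ tosemifrac b * k = tosemifrac a.
Proof.
move: k; elim/quotW=> x; exists x.1, x.2; split; first exact: SemiFrac.denom_neq0.
rewrite [LHS]SemiFrac.pi_mul; apply/eqP/SemiFrac.piP => /=.
by rewrite mulr1 mul1r.
Qed.

Lemma semifrac_inv (k : {semifrac S}) : k != 0 -> exists k', k * k' = 1.
Proof.
have [a [b [b0 kE]]] := semifracP k => k0.
have a0 : a != 0.
  apply: contra_neq k0 => a0; have [b' bb'] := tosemifrac_inv b0.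
  by rewrite -[k]mul1r -bb' mulrAC kE a0 rmorph0 mul0r.
have [a' aa'] := tosemifrac_inv a0.
by exists (tosemifrac b * a'); rewrite mulrA [k * _]mulrC kE.
Qed.

End SemiFracTheory.

(* The set of finite sums of products; n = 0 gives the empty sum 0, which is
   also obtained as a nonempty sum when A and B are (fractional) ideals. *)
Definition prod_set (R : comNzSemiRingType) (A B : set R) : set R :=
  [set x | exists (n : nat) (a b : 'I_n -> R),
     [/\ forall i, A (a i), forall i, B (b i) & x = \sum_(i < n) a i * b i]].

Section Ideals.
Context (S : comNzSemiRingType).

Definition is_ideal (I : set S) : Prop :=
  [/\ I !=set0,
      forall x y, I x -> I y -> I (x + y)
    & forall s x, I x -> I (s * x)].

Definition finitely_generated (I : set S) : Prop :=
  exists (n : nat) (g : 'I_n -> S),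
    I = [set x | exists r : 'I_n -> S, x = \sum_(i < n) r i * g i].

Definition noetherian : Prop :=
  forall I : set S, is_ideal I -> finitely_generated I.

Definition multiplication_semiring : Prop :=
  forall I J : set S, is_ideal I -> is_ideal J -> I `<=` J ->
    exists L : set S, is_ideal L /\ I = prod_set J L.

End Ideals.

Section FractionalIdeals.
Context (S : semidomainType).
Local Notation K := {semifrac S}.

Definition is_fractional_ideal (A : set K) : Prop :=
  [/\ A !=set0,
      forall x y, A x -> A y -> A (x + y),
      forall (s : S) x, A x -> A (tosemifrac s * x)
    & exists2 d : S, d != 0 &
        [set tosemifrac d * x | x in A] `<=` range (tosemifrac : S -> K)].

Definition invertible (A : set K) : Prop :=
  exists B : set K,
    is_fractional_ideal B /\ prod_set A B = range (tosemifrac : S -> K).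

Definition dedekind : Prop :=
  forall A : set K, is_fractional_ideal A -> A <> [set 0] -> invertible A.

End FractionalIdeals.

Arguments noetherian S : clear implicits.
Arguments multiplication_semiring S : clear implicits.
Arguments dedekind S : clear implicits.

(* Main.v *)
From mathcomp Require Import all_boot all_algebra.
From mathcomp Require Import boolp classical_sets.
Require Import Defs.

Set Implicit Arguments.
Unset Strict Implicit.
Unset Printing Implicit Defensive.

Import GRing.Theory.

Local Open Scope classical_set_scope.
Local Open Scope ring_scope.

(** If [S] is multiplication and [A] is a nonzero fractional ideal with
    denominator [d], pick [a != 0] in the ideal [d A]; since [aS] is contained
    in [d A], there is an ideal [L] with [aS = (d A) L], and [(d / a) L] is an
    inverse of [A].  Conversely, if [I] is contained in [J], [J] is nonzero and
    [J B = S], then [I B] is contained in [J B = S], so it is an ideal of [S],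
    and [J (I B) = I]. *)

Lemma image_preimage_range (T U : Type) (f : T -> U) (B : set U) :
  B `<=` range f -> f @` (f @^-1` B) = B.
Proof.
move=> fB; apply/seteqP; split=> [|y By]; first exact: image_preimage_subset.
by have [x _ fx] := fB _ By; exists x; rewrite //= fx.
Qed.

(** Lets an equation between ideals of [S] be proved between their images in the semifield of
    fractions. *)
Lemma image_set_inj (T U : Type) (f : T -> U) :
  injective f -> injective (fun A : set T => f @` A).
Proof.
move=> f_inj A B AB; apply/funext => x.
by rewrite -(image_inj (A := A) f_inj) AB image_inj.
Qed.

Section ProdSet.
Context (R : comNzSemiRingType).
Implicit Types A B C : set R.

Lemma prod_setM A B x y : A x -> B y -> prod_set A B (x * y).
Proof.
by move=> Ax By; exists 1%N, (fun=> x), (fun=> y); split; rewrite ?big_ord1.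
Qed.

Lemma prod_set0 A B : prod_set A B 0.
Proof.
by exists 0%N, (fun=> 0), (fun=> 0); split; rewrite ?big_ord0// => -[].
Qed.

Lemma prod_setD A B x y :
  prod_set A B x -> prod_set A B y -> prod_set A B (x + y).
Proof.
move=> [m [a [b [Aa Bb ->]]]] [n [c [e [Ac Be ->]]]].
pose glue (u : 'I_m -> R) (v : 'I_n -> R) i :=
  match split i with inl j => u j | inr j => v j end.
exists (m + n)%N, (glue a c), (glue b e); split=> [i|i|].
- by rewrite /glue; case: split.
- by rewrite /glue; case: split.
rewrite big_split_ord /glue; congr (_ + _); apply: eq_bigr => i _.
  by rewrite (unsplitK (inl i)).
by rewrite (unsplitK (inr i)).
Qed.

(** Induction principle for products: an additive submonoid that contains the generators [x * y]
    contains all their finite sums. It replaces most computations with explicit sums below. *)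
Lemma prod_set_sub A B C :
  C 0 -> (forall x y, C x -> C y -> C (x + y)) ->
  (forall x y, A x -> B y -> C (x * y)) -> prod_set A B `<=` C.
Proof.
move=> C0 CD CM _ [n [a [b [Aa Bb ->]]]].
by apply: (big_ind C) => // i _; apply: CM.
Qed.

Lemma prod_setS A A' B B' :
  A `<=` A' -> B `<=` B' -> prod_set A B `<=` prod_set A' B'.
Proof.
move=> sA sB; apply: prod_set_sub; [exact: prod_set0|exact: prod_setD|].
by move=> x y /sA Ax /sB By; apply: prod_setM.
Qed.

Lemma prod_setC A B : prod_set A B = prod_set B A.
Proof.
suff sub A' B' : prod_set A' B' `<=` prod_set B' A'.
  by apply/seteqP; split; apply: sub.
apply: prod_set_sub; [exact: prod_set0|exact: prod_setD|].
by move=> x y Ax By; rewrite mulrC; apply: prod_setM.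
Qed.

(** Left-commutativity is the form that turns [J (I B)] into [I (J B)]. Being symmetric in [A] and
    [B], it needs only one inclusion. *)
Lemma prod_setCA A B C :
  prod_set A (prod_set B C) = prod_set B (prod_set A C).
Proof.
suff sub A' B' : prod_set A' (prod_set B' C) `<=` prod_set B' (prod_set A' C).
  by apply/seteqP; split; apply: sub.
apply: prod_set_sub; [exact: prod_set0|exact: prod_setD|].
(* With [x] fixed, the [z] for which [x * z] lies in the target form an additive submonoid, so a
   second induction reduces to a single product. *)
move=> x z Ax; move: z; apply: prod_set_sub => [|y z|y z By Cz].
- by rewrite mulr0; apply: prod_set0.
- by rewrite mulrDr; apply: prod_setD.
- by rewrite mulrCA; do 2!apply: prod_setM => //.
Qed.

End ProdSet.

Lemma image_prod_set (R R' : comNzSemiRingType) (f : {rmorphism R -> R'})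
    (A B : set R) :
  f @` prod_set A B = prod_set (f @` A) (f @` B).
Proof.
apply/seteqP; split=> [_ [_ [n [a [b [Aa Bb ->]]]] <-]|].
  rewrite rmorph_sum; exists n, (f \o a), (f \o b); split=> [i|i|].
  - by exists (a i).
  - by exists (b i).
  - by apply: eq_bigr => i _; rewrite rmorphM.
apply: prod_set_sub => [|_ _ [x ABx <-] [y ABy <-]|_ _ [x Ax <-] [y By <-]].
- by exists 0; rewrite ?rmorph0//; apply: prod_set0.
- by exists (x + y); rewrite ?rmorphD//; apply: prod_setD.
- by exists (x * y); rewrite ?rmorphM//; apply: prod_setM.
Qed.

Lemma prod_setZl (R : comNzSemiRingType) (c : R) (A B : set R) :
  prod_set ( *%R c @` A) B = *%R c @` prod_set A B.
Proof.
apply/seteqP; split=> [|_ [_ [n [a [b [Aa Bb ->]]]] <-]].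
  apply: prod_set_sub => [|_ _ [x ABx <-] [y ABy <-]|_ y [x Ax <-] By].
  - by exists 0; rewrite ?mulr0//; apply: prod_set0.
  - by exists (x + y); rewrite ?mulrDr//; apply: prod_setD.
  - by exists (x * y); rewrite ?mulrA//; apply: prod_setM.
exists n, (fun i => c * a i), b; split=> // [i|]; first by exists (a i).
by rewrite mulr_sumr; apply: eq_bigr => i _; rewrite mulrA.
Qed.

Lemma is_ideal0 (S : comNzSemiRingType) (I : set S) : is_ideal I -> I 0.
Proof. by case=> -[x Ix] _ IZ; rewrite -(mul0r x); apply: IZ. Qed.

Section FractionalIdeals.
Context (S : semidomainType).
Local Notation K := {semifrac S}.
Local Notation f := (tosemifrac : S -> K).

Lemma is_fractional_ideal0 (A : set K) : is_fractional_ideal A -> A 0.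
Proof.
by case=> -[x Ax] _ AZ _; rewrite -(mul0r x) -(rmorph0 f); apply: AZ.
Qed.

Lemma ideal_fractional (I : set S) :
  is_ideal I -> is_fractional_ideal (f @` I).
Proof.
case=> -[x Ix] ID IZ; split.
- by exists (f x); exists x.
- by move=> _ _ [y Iy <-] [z Iz <-]; exists (y + z); rewrite ?rmorphD//; apply: ID.
- by move=> s _ [y Iy <-]; exists (s * y); rewrite ?rmorphM//; apply: IZ.
- exists 1; first exact: oner_neq0.
  by move=> _ [_ [y Iy <-] <-]; exists y; rewrite ?rmorph1 ?mul1r.
Qed.

Lemma prod_set_range (A : set K) :
  is_fractional_ideal A -> prod_set A (range f) = A.
Proof.
move=> fA; have A0 := is_fractional_ideal0 fA; case: fA => _ AD AZ _.
apply/seteqP; split=> [|x Ax].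
  by apply: prod_set_sub => // x _ Ax [s _ <-]; rewrite mulrC; apply: AZ.
rewrite -[x]mulr1 -(rmorph1 f); exact: prod_setM.
Qed.

(** The closure properties are listed separately so that products can be pulled back without
    exhibiting a common denominator. *)
Lemma preimage_is_ideal (A : set K) :
  A 0 -> (forall x y, A x -> A y -> A (x + y)) ->
  (forall (s : S) x, A x -> A (f s * x)) -> is_ideal (f @^-1` A).
Proof.
move=> A0 AD AZ; split=> [|x y|s x] /=.
- by exists 0; rewrite /= rmorph0.
- by rewrite rmorphD; apply: AD.
- by rewrite rmorphM; apply: AZ.
Qed.

Lemma multiplication_dedekind : multiplication_semiring S -> dedekind S.
Proof.
move=> mS A fA nA; have A0 := is_fractional_ideal0 fA.
case: (fA) => _ AD AZ [d d0 dA].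
have [x Ax x0] : exists2 x, A x & x != 0.
  apply: contrapT => noA; apply: nA; apply/seteqP; split=> [x Ax|_ ->] //=.
  by apply: contrapT => /eqP x0; apply: noA; exists x.
have [a _ fa] : range f (f d * x) by apply: dA; exists x.
have a0 : a != 0.
  apply: contra_neq x0 => a0; have [d' dd'] := tosemifrac_inv d0.
  by rewrite -[x]mul1r -dd' mulrAC -fa a0 rmorph0 mul0r.
(* [J] is [d A] seen inside [S]; it contains [a], the element of [S] representing [d x]. *)
pose J := f @^-1` ( *%R (f d) @` A).
have fJ : f @` J = *%R (f d) @` A by exact: image_preimage_range.
have iJ : is_ideal J.
  apply: preimage_is_ideal.
  - by exists 0; rewrite ?mulr0.
  - by move=> _ _ [y Ay <-] [z Az <-]; exists (y + z); rewrite ?mulrDr//; apply: AD.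
  - by move=> s _ [y Ay <-]; exists (f s * y); [apply: AZ|rewrite mulrCA].
have Ja : J a by exists x.
have iaS : is_ideal (range ( *%R a)).
  split=> [|_ _ [s _ <-] [t _ <-]|s _ [t _ <-]].
  - by exists (a * 1); exists 1.
  - by exists (s + t); rewrite ?mulrDr.
  - by exists (s * t); rewrite // mulrCA.
have [|L [iL aSE]] := mS _ _ iaS iJ.
  by case: (iJ) => _ _ JZ _ [s _ <-]; rewrite mulrC; apply: JZ.
(* [u] is [1 / a], so [u * f d] below is the factor [d / a]. *)
have [u au] := tosemifrac_inv a0.
have [_ LD LZ _] := ideal_fractional iL.
exists ( *%R (u * f d) @` (f @` L)); split.
  split.
  - by exists (u * f d * f 0); exists (f 0) => //; exists 0 => //; apply: is_ideal0.
  - by move=> _ _ [y Ly <-] [z Lz <-]; exists (y + z); rewrite ?mulrDr//; apply: LD.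
  - by move=> s _ [y Ly <-]; exists (f s * y); [apply: LZ|rewrite mulrCA].
  (* [a] is a denominator, since [a (d / a) L = d L] lies in [S]. *)
  - exists a => // _ [_ [_ [s Ls <-] <-] <-]; exists (d * s) => //.
    by rewrite !mulrA au mul1r rmorphM.
have -> : *%R (u * f d) @` (f @` L) = *%R u @` ( *%R (f d) @` (f @` L)).
  rewrite [RHS]image_comp; apply: eq_imagel => y _ /=.
  by rewrite mulrA.
(* The scalar [d] moves from [L] over to [A]: [A (u d L) = u ((d A) L) = u (J L) = u (a S)], and
   [u a = 1] leaves [S]. *)
rewrite prod_setC !prod_setZl prod_setC -prod_setZl -fJ -image_prod_set -aSE.
apply/seteqP; split=> [_ [_ [_ [s _ <-] <-] <-]|_ [s _ <-]].
  by exists s => //; rewrite rmorphM mulrA [u * _]mulrC au mul1r.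
exists (f (a * s)); first by exists (a * s) => //; exists s.
by rewrite rmorphM mulrA [u * _]mulrC au mul1r.
Qed.

Lemma dedekind_multiplication : dedekind S -> multiplication_semiring S.
Proof.
move=> dS I J iI iJ IJ; have [J0|nJ] := pselect (J = [set 0]).
  (* The zero ideal is outside the reach of [dedekind], but then [I] is also zero and
     [0 = 0 * 0]. *)
  exists J; split=> //; apply/seteqP; split=> [x /IJ|].
    by rewrite J0 => ->; apply: prod_set0.
  apply: prod_set_sub; first exact: is_ideal0.
    by case: iI.
  by rewrite J0 => x y -> _; rewrite mul0r; apply: is_ideal0.
have [|B [fB JB]] := dS _ (ideal_fractional iJ).
  move=> fJ0; apply: nJ; apply/seteqP; split=> [x Jx|_ ->]; last exact: is_ideal0.
  by apply: (@tosemifrac_inj S); rewrite rmorph0; move: (imageP f Jx); rewrite fJ0.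
have sub : prod_set (f @` I) B `<=` range f.
  by rewrite -JB; apply: prod_setS => //; apply: image_subset.
exists (f @^-1` prod_set (f @` I) B); split.
  apply: preimage_is_ideal; [exact: prod_set0|exact: prod_setD|].
  move=> s; apply: prod_set_sub => [|x y|x y Ix By].
  - by rewrite mulr0; apply: prod_set0.
  - by rewrite mulrDr; apply: prod_setD.
  - rewrite mulrA; apply: prod_setM => //.
    by have [_ _ IZ _] := ideal_fractional iI; apply: IZ.
have fL : f @` (f @^-1` prod_set (f @` I) B) = prod_set (f @` I) B.
  exact: image_preimage_range.
apply: (image_set_inj (@tosemifrac_inj S)).
(* In the semifield, [J (I B) = I (J B) = I S = I]. *)
rewrite image_prod_set fL prod_setCA JB prod_set_range//.
exact: ideal_fractional.
Qed.

End FractionalIdeals.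

Theorem theorem3p15 (S : semidomainType) (hN : noetherian S) :
  multiplication_semiring S <-> dedekind S.
Proof.
by split; [exact: multiplication_dedekind|exact: dedekind_multiplication].
Qed.
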